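(* Let $(M,g)$ be a pseudo-Riemannian manifold, let $\nabla$ be the Levi-Civita connection of $g$ and let $J$ be an invertible $g$-symmetric $(1,1)$-tensor field on $M$ such that $(\nabla_XJ)Y=(\nabla_YJ)X$ for all vector fields $X,Y$. Let $\tilde g(X,Y)=g(X,JY)$, let $\nabla^*$ be the dual connection of $\nabla$ with respect to $\tilde g$, and let $\nabla^{(\alpha)}=\frac{1+\alpha}{2}\nabla+\frac{1-\alpha}{2}\nabla^*$. Let $$\hat J=\begin{pmatrix} J & (I-J^2)\tilde g^{-1}\\ \tilde g & -J^*\end{pmatrix}$$ be the generalized almost product structure on $TM\oplus T^*M$ induced by $(\tilde g,J)$. Then $$N_{\hat J}^{\nabla^{(\alpha)}}(X+\eta,Y+\beta)=N_{\hat J}^{\nabla}(X+\eta,Y+\beta)$$ for all vector fields $X,Y$, all $1$-forms $\eta,\beta$ and all $\alpha\in\mathbb{R}$ if and only if the tensor field $F(X,Y,Z)=\tilde g((\nabla_XJ)Y,Z)$ satisfies $$F(Y,Z,X)-F(X,Z,Y)=0$$ for all vector fields $X,Y,Z$ on $M$.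
   Context: $J$ is $g$-symmetric if $g(JX,Y)=g(X,JY)$. The tensor $\tilde g$ is identified with the bundle isomorphism $\tilde g:TM\to T^*M$, $\tilde g(X)=\tilde g(X,\cdot)$, with inverse $\tilde g^{-1}$; $(J^*\eta)(X)=\eta(JX)$. The matrix means $\hat J(X+\eta)=JX+(I-J^2)\tilde g^{-1}(\eta)+\tilde g(X)-J^*\eta$. The dual connection $\nabla^*$ is defined by $X(\tilde g(Y,Z))=\tilde g(\nabla_XY,Z)+\tilde g(Y,\nabla^*_XZ)$. For an affine connection $D$ on $M$ (acting on $1$-forms by $(D_X\beta)(Y)=X(\beta(Y))-\beta(D_XY)$), the bracket on sections of $TM\oplus T^*M$ is $[X+\eta,Y+\beta]_D=[X,Y]+D_X\beta-D_Y\eta$, and the Nijenhuis tensor of $\hat J$ with respect to $D$ is $N_{\hat J}^{D}(\sigma,\tau)=[\hat J\sigma,\hat J\tau]_D-\hat J[\hat J\sigma,\tau]_D-\hat J[\sigma,\hat J\tau]_D+\hat J^2[\sigma,\tau]_D$. *)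

(* Defs.v *)
From HB Require Import structures.
From mathcomp Require Import all_boot all_order all_algebra.
From mathcomp Require Import all_classical all_reals all_analysis.

Set Implicit Arguments.
Unset Strict Implicit.
Unset Printing Implicit Defensive.

Import Order.TTheory GRing.Theory Num.Theory.
Import numFieldNormedType.Exports.

Local Open Scope classical_set_scope.
Local Open Scope ring_scope.

Section SmoothEuclidean.
Context {R : realType} {n : nat}.
Implicit Types (U : set 'rV[R]_n) (f g : 'rV[R]_n -> R).

(* Only meaningful for open U: limits and derivatives are those of the ambient
   space.  Continuity of f is implied by that of its partial derivatives when
   k > 0; stating it at each order makes C^(k+1) a part of C^k by definition. *)
Fixpoint Ck (k : nat) U f : Prop :=
  (forall x, U x -> {for x, continuous f}) /\
  if k is k'.+1 then
    forall i : 'I_n, (forall x, U x -> derivable f x 'e_i) /\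
      Ck k' U ('D_'e_i f)
  else True.

Definition smooth_on U f := forall k, Ck k U f.

Definition smooth_map_on {m : nat} U (F : 'rV[R]_n -> 'rV[R]_m) :=
  forall j : 'I_m, smooth_on U (fun x => F x 0 j).

Lemma near_open U f g x : open U -> (forall y, U y -> f y = g y) -> U x ->
  {near x, f =1 g}.
Proof.
move=> Uo fg Ux.
have : nbhs x U by exact: open_nbhs_nbhs.
by apply: filterS => y /fg.
Qed.

Lemma CkW k U f : Ck k.+1 U f -> Ck k U f.
Proof.
elim: k f => [|k IH] f [cf Df]; first by split.
by split=> // i; have [dfi Dfi] := Df i; split=> //; exact: IH.
Qed.

Lemma eq_Ck k U f g : open U -> (forall x, U x -> f x = g x) ->
  Ck k U f -> Ck k U g.
Proof.
move=> Uo.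
have cont (h1 h2 : 'rV[R]_n -> R) : (forall x, U x -> h1 x = h2 x) ->
    (forall x, U x -> {for x, continuous h1}) ->
    forall x, U x -> {for x, continuous h2}.
  move=> fg ch x Ux; rewrite /prop_for /continuous_at -(fg x Ux).
  apply: cvg_trans (ch x Ux); apply: (@near_eq_cvg _ _ (nbhs x)).
  exact: (near_open Uo fg Ux).
elim: k f g => [|k IH] f g fg [cf Df]; first by split=> //; exact: cont fg cf.
split; first exact: cont fg cf.
move=> i; have [dfi Dfi] := Df i; split=> [x Ux|].
  by apply: near_eq_derivable (dfi x Ux); exact: (near_open Uo fg Ux).
apply: (IH ('D_'e_i f)) => // x Ux.
exact: (near_eq_derive _ (near_open Uo fg Ux)).
Qed.

Lemma Ck_cst k U (a : R) : Ck k U (cst a).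
Proof.
elim: k a => [|k IH] a.
  by split=> // x _; exact: cst_continuous.
split=> [x _|i]; first exact: cst_continuous.
split=> [x _|]; first exact: derivable_cst.
suff -> : 'D_'e_i (cst a) = cst 0 :> ('rV[R]_n -> R) by exact: IH.
by apply/funext => x; rewrite derive_cst.
Qed.

Lemma CkD k U f g : open U -> Ck k U f -> Ck k U g -> Ck k U (f + g).
Proof.
move=> Uo; elim: k f g => [|k IH] f g [cf Df] [cg Dg].
  by split=> // x Ux; exact: cvgD (cf x Ux) (cg x Ux).
split=> [x Ux|i]; first exact: cvgD (cf x Ux) (cg x Ux).
have [dfi Dfi] := Df i; have [dgi Dgi] := Dg i; split=> [x Ux|].
  by apply: derivableD; [exact: dfi|exact: dgi].
apply: eq_Ck (IH _ _ Dfi Dgi) => // x Ux.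
by rewrite [RHS]deriveD//; [exact: dfi|exact: dgi].
Qed.

Lemma CkM k U f g : open U -> Ck k U f -> Ck k U g -> Ck k U (f * g).
Proof.
move=> Uo; elim: k f g => [|k IH] f g.
  by move=> [cf _] [cg _]; split=> // x Ux; exact: cvgM (cf x Ux) (cg x Ux).
move=> Cf Cg; have [cf Df] := Cf; have [cg Dg] := Cg.
split=> [x Ux|i]; first exact: cvgM (cf x Ux) (cg x Ux).
have [dfi Dfi] := Df i; have [dgi Dgi] := Dg i; split=> [x Ux|].
  by apply: derivableM; [exact: dfi|exact: dgi].
have Cfg := CkD Uo (IH _ _ (CkW Cf) Dgi) (IH _ _ (CkW Cg) Dfi).
apply: eq_Ck Cfg => // x Ux.
by rewrite [RHS]deriveM//; [exact: dfi|exact: dgi].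
Qed.

Lemma smooth_on_cst U (a : R) : smooth_on U (cst a).
Proof. by move=> k; exact: Ck_cst. Qed.

Lemma smooth_onD U f g : open U -> smooth_on U f -> smooth_on U g ->
  smooth_on U (f + g).
Proof. by move=> Uo sf sg k; exact: CkD. Qed.

Lemma smooth_onM U f g : open U -> smooth_on U f -> smooth_on U g ->
  smooth_on U (f * g).
Proof. by move=> Uo sf sg k; exact: CkM. Qed.

End SmoothEuclidean.

(* The inverse of a chart is a total function, constrained on the image of the
   chart only. *)
Record chart (R : realType) (n : nat) (T : topologicalType) := Chart {
  chart_dom : set T;
  chart_map : T -> 'rV[R]_n;
  chart_inv : 'rV[R]_n -> T;
  chart_dom_open : open chart_dom;
  chart_img_open : open (chart_map @` chart_dom);
  chart_mapK : forall p, chart_dom p -> chart_inv (chart_map p) = p;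
  chart_map_continuous : {within chart_dom, continuous chart_map};
  chart_inv_continuous :
    {within chart_map @` chart_dom, continuous chart_inv}
}.

Definition chart_img R n T (c : chart R n T) := chart_map c @` chart_dom c.

(* The atlas need not be maximal: it has the same smooth functions as the
   maximal atlas it generates. *)
Record manifold (R : realType) (n : nat) := Manifold {
  manifold_sort :> topologicalType;
  manifold_hausdorff : hausdorff_space manifold_sort;
  manifold_second_countable : @second_countable manifold_sort;
  atlas : set (chart R n manifold_sort);
  atlas_cover : forall p, exists2 c, atlas c & chart_dom c p;
  atlas_compatible : forall c d, atlas c -> atlas d ->
    smooth_map_on (chart_map c @` (chart_dom c `&` chart_dom d))
      (chart_map d \o chart_inv c)
}.

Section SmoothFunctions.
Context {R : realType} {n : nat} (M : manifold R n).

Definition smooth_pred : {pred M -> R} := fun f =>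
  `[< forall c, atlas c -> smooth_on (chart_img c) (f \o chart_inv c) >].

Lemma smooth_cst (a : R) : (cst a : M -> R) \in smooth_pred.
Proof. by apply/asboolP => c _; exact: smooth_on_cst. Qed.

Lemma smooth_subring_closed : subring_closed smooth_pred.
Proof.
split=> [|f g|f g].
- exact: smooth_cst.
- move=> /asboolP sf /asboolP sg; apply/asboolP => c Ac.
  have Uo := @chart_img_open _ _ _ c.
  have -> : (f - g) \o chart_inv c =
      (f \o chart_inv c) + (cst (-1) * (g \o chart_inv c)).
    by apply/funext => x /=; rewrite /GRing.mul /GRing.add /= mulN1r.
  apply: smooth_onD => //; first exact: sf.
  by apply: smooth_onM => //; [exact: smooth_on_cst | exact: sg].
- move=> /asboolP sf /asboolP sg; apply/asboolP => c Ac.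
  apply: (smooth_onM (@chart_img_open _ _ _ c)); [exact: sf|exact: sg].
Qed.

Record Cinf := MkCinf { Cinf_fun :> M -> R; CinfP : Cinf_fun \in smooth_pred }.

HB.instance Definition _ := [isSub for Cinf_fun].
HB.instance Definition _ := [Choice of Cinf by <:].
HB.instance Definition _ := GRing.SubChoice_isSubComPzRing.Build
  (M -> R) smooth_pred Cinf smooth_subring_closed.

Definition cstC (a : R) : Cinf := MkCinf (smooth_cst a).

End SmoothFunctions.

Section VectorFields.
Context {R : realType} {n : nat} (M : manifold R n).
Local Notation C := (Cinf M).

(* Vector fields are derivations of the algebra of smooth functions. *)
Record vfield := VField {
  vfield_fun :> C -> C;
  vfield_linear : forall (a : R) (f h : C),
    vfield_fun (cstC M a * f + h) = cstC M a * vfield_fun f + vfield_fun h;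
  vfield_leibniz : forall f h : C,
    vfield_fun (f * h) = vfield_fun f * h + f * vfield_fun h
}.

Lemma vfield_eqP (X Y : vfield) : (forall f, X f = Y f) -> X = Y.
Proof.
case: X Y => X lX dX [Y lY dY] /= XY.
have {}XY : X = Y by exact/funext.
by subst Y; congr VField; exact: Prop_irrelevance.
Qed.

HB.instance Definition _ := gen_eqMixin vfield.
HB.instance Definition _ := gen_choiceMixin vfield.

Lemma vfield0_linear (a : R) (f h : C) : 0 = cstC M a * 0 + 0 :> C.
Proof. by rewrite mulr0 addr0. Qed.
Lemma vfield0_leibniz (f h : C) : 0 = 0 * h + f * 0 :> C.
Proof. by rewrite mulr0 mul0r addr0. Qed.
Definition vfield0 : vfield := VField vfield0_linear vfield0_leibniz.

Section Add.
Variables X Y : vfield.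
Lemma vfieldD_linear (a : R) (f h : C) :
  X (cstC M a * f + h) + Y (cstC M a * f + h) =
  cstC M a * (X f + Y f) + (X h + Y h).
Proof. by rewrite !vfield_linear mulrDr addrACA. Qed.
Lemma vfieldD_leibniz (f h : C) :
  X (f * h) + Y (f * h) = (X f + Y f) * h + f * (X h + Y h).
Proof. by rewrite !vfield_leibniz mulrDr mulrDl addrACA. Qed.
Definition vfieldD : vfield := VField vfieldD_linear vfieldD_leibniz.
End Add.

Section Scale.
Variables (u : C) (X : vfield).
Lemma vfieldZ_linear (a : R) (f h : C) :
  u * X (cstC M a * f + h) = cstC M a * (u * X f) + u * X h.
Proof. by rewrite vfield_linear mulrDr mulrCA. Qed.
Lemma vfieldZ_leibniz (f h : C) :
  u * X (f * h) = u * X f * h + f * (u * X h).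
Proof. by rewrite vfield_leibniz mulrDr mulrA (mulrCA u). Qed.
Definition vfieldZ : vfield := VField vfieldZ_linear vfieldZ_leibniz.
End Scale.

Definition vfieldN := vfieldZ (- 1).

Lemma vfieldDA : associative vfieldD.
Proof. by move=> X Y Z; apply: vfield_eqP => f /=; rewrite addrA. Qed.
Lemma vfieldDC : commutative vfieldD.
Proof. by move=> X Y; apply: vfield_eqP => f /=; rewrite addrC. Qed.
Lemma vfield0D : left_id vfield0 vfieldD.
Proof. by move=> X; apply: vfield_eqP => f /=; rewrite add0r. Qed.
Lemma vfieldND : left_inverse vfield0 vfieldN vfieldD.
Proof. by move=> X; apply: vfield_eqP => f /=; rewrite mulN1r addNr. Qed.

HB.instance Definition _ :=
  GRing.isZmodule.Build vfield vfieldDA vfieldDC vfield0D vfieldND.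

Lemma vfieldZA (u v : C) (X : vfield) :
  vfieldZ u (vfieldZ v X) = vfieldZ (u * v) X.
Proof. by apply: vfield_eqP => f /=; rewrite mulrA. Qed.
Lemma vfield1Z : left_id 1 vfieldZ.
Proof. by move=> X; apply: vfield_eqP => f /=; rewrite mul1r. Qed.
Lemma vfieldZDr : right_distributive vfieldZ +%R.
Proof. by move=> u X Y; apply: vfield_eqP => f /=; rewrite mulrDr. Qed.
Lemma vfieldZDl X : {morph vfieldZ^~ X : u v / u + v}.
Proof. by move=> u v; apply: vfield_eqP => f /=; rewrite mulrDl. Qed.

HB.instance Definition _ := GRing.Zmodule_isLmodule.Build C vfield
  vfieldZA vfield1Z vfieldZDr vfieldZDl.

Section Bracket.
Variables X Y : vfield.

Lemma lie_linear (a : R) (f h : C) :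
  X (Y (cstC M a * f + h)) - Y (X (cstC M a * f + h)) =
  cstC M a * (X (Y f) - Y (X f)) + (X (Y h) - Y (X h)).
Proof. by rewrite !vfield_linear mulrBr opprD addrACA. Qed.

Lemma vfield_funD (Z : vfield) (f h : C) : Z (f + h) = Z f + Z h.
Proof.
have cst1 : cstC M 1 = 1 by exact: val_inj.
by have := vfield_linear Z 1 f h; rewrite cst1 !mul1r.
Qed.

Lemma lie_leibniz (f h : C) :
  X (Y (f * h)) - Y (X (f * h)) =
  (X (Y f) - Y (X f)) * h + f * (X (Y h) - Y (X h)).
Proof.
rewrite !vfield_leibniz !vfield_funD !vfield_leibniz mulrBl mulrBr.
set a := X (Y f) * h; set b := Y f * X h; set c := X f * Y h.
set d := f * X (Y h); set e := Y (X f) * h; set k := f * Y (X h).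
rewrite -/a -/b -/c -/d -/e -/k.
rewrite [a + b + _](AC (2*2) ((2*3)*(1*4))).
rewrite [e + c + _](AC (2*2) ((3*2)*(1*4))).
by rewrite opprD addrACA subrr add0r opprD addrACA.
Qed.

Definition lie : vfield := VField lie_linear lie_leibniz.
End Bracket.

End VectorFields.

Section OneForms.
Context {R : realType} {n : nat} (M : manifold R n).
Local Notation C := (Cinf M).
Local Notation X_M := (vfield M).

(* Sections of bundles are handled through the C^oo(M)-modules they form:
   tensor fields are C^oo(M)-multilinear maps. *)
Definition one_form := {scalar X_M}.

Lemma one_form_eqP (eta beta : one_form) : eta =1 beta -> eta = beta.
Proof.
case: eta beta => f [[p1] [p2]] [h [[q1] [q2]]] /= fh.
have {}fh : f = h by exact/funext.
by subst h; rewrite (Prop_irrelevance p1 q1) (Prop_irrelevance p2 q2).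
Qed.

Definition mk_form (f : X_M -> C) (lf : linear_for *%R f) : one_form :=
  HB.pack f (GRing.isLinear.Build C X_M C *%R f lf).

HB.instance Definition _ := gen_eqMixin one_form.
HB.instance Definition _ := gen_choiceMixin one_form.

Lemma form0_linear : linear_for *%R (fun _ : X_M => 0 : C).
Proof. by move=> u X Y; rewrite mulr0 addr0. Qed.
Lemma formD_linear (eta beta : one_form) :
  linear_for *%R (fun X => eta X + beta X).
Proof. by move=> u X Y; rewrite !linearP mulrDr addrACA. Qed.
Lemma formZ_linear (u : C) (eta : one_form) :
  linear_for *%R (fun X => u * eta X).
Proof. by move=> v X Y; rewrite linearP mulrDr mulrCA. Qed.

Definition form0 := mk_form form0_linear.
Definition formD eta beta := mk_form (formD_linear eta beta).
Definition formZ u eta := mk_form (formZ_linear u eta).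
Definition formN := formZ (- 1).

Lemma formDA : associative formD.
Proof. by move=> a b c; apply: one_form_eqP => X /=; rewrite addrA. Qed.
Lemma formDC : commutative formD.
Proof. by move=> a b; apply: one_form_eqP => X /=; rewrite addrC. Qed.
Lemma form0D : left_id form0 formD.
Proof. by move=> a; apply: one_form_eqP => X /=; rewrite add0r. Qed.
Lemma formND : left_inverse form0 formN formD.
Proof. by move=> a; apply: one_form_eqP => X /=; rewrite mulN1r addNr. Qed.

HB.instance Definition _ :=
  GRing.isZmodule.Build one_form formDA formDC form0D formND.

Lemma formZA (u v : C) (eta : one_form) :
  formZ u (formZ v eta) = formZ (u * v) eta.
Proof. by apply: one_form_eqP => X /=; rewrite mulrA. Qed.
Lemma form1Z : left_id 1 formZ.
Proof. by move=> a; apply: one_form_eqP => X /=; rewrite mul1r. Qed.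
Lemma formZDr : right_distributive formZ +%R.
Proof. by move=> u a b; apply: one_form_eqP => X /=; rewrite mulrDr. Qed.
Lemma formZDl a : {morph formZ^~ a : u v / u + v}.
Proof. by move=> u v; apply: one_form_eqP => X /=; rewrite mulrDl. Qed.

HB.instance Definition _ := GRing.Zmodule_isLmodule.Build C one_form
  formZA form1Z formZDr formZDl.

End OneForms.

Section Geometry.
Context {R : realType} {n : nat} (M : manifold R n).
Local Notation C := (Cinf M).
Local Notation X_M := (vfield M).
Implicit Types X Y Z : X_M.

Definition tensor11 := {linear X_M -> X_M}.

(* A (0,2)-tensor h is the morphism X |-> h(X, -), so that h X Y is its value
   on the pair (X, Y). *)
Definition tensor02 := {linear X_M -> one_form M}.

Lemma pullback_linear (J : tensor11) (eta : one_form M) :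
  linear_for *%R (fun X => eta (J X)).
Proof. by move=> u X Y; rewrite !linearP. Qed.
Definition pullback J eta : one_form M := mk_form (pullback_linear J eta).

Lemma twist_linear (h : tensor02) (J : tensor11) :
  linear (fun X => pullback J (h X)).
Proof.
by move=> u X Y; apply: one_form_eqP => Z /=; rewrite linearP.
Qed.
Definition twist (h : tensor02) (J : tensor11) : tensor02 :=
  HB.pack (fun X => pullback J (h X))
    (GRing.isLinear.Build C X_M (one_form M) *:%R _ (twist_linear h J)).

(* The inverse one_form M -> vfield M of X |-> h(X, -); a default value is
   returned outside the range of h. *)
Definition sharp (h : tensor02) (eta : one_form M) : X_M :=
  xget 0 [set X | h X = eta].

(* Nondegeneracy: X |-> g(X, -) is a bundle isomorphism from TM to T^*M, i.e. it
   is bijective on sections.  The index is locally constant; it is not required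
   to agree on distinct components of M. *)
Definition pseudo_riemannian (g : tensor02) :=
  (forall X Y, g X Y = g Y X) /\ bijective g.

Definition tensor_invertible (J : tensor11) :=
  exists K : tensor11, cancel J K /\ cancel K J.

Definition g_symmetric (g : tensor02) (J : tensor11) :=
  forall X Y, g (J X) Y = g X (J Y).

Record connection := Connection {
  cov :> X_M -> X_M -> X_M;
  cov_linear : forall Y, linear (cov^~ Y);
  cov_additive : forall X, {morph cov X : Y Z / Y + Z};
  cov_leibniz : forall X (f : C) Y,
    cov X (f *: Y) = X f *: Y + f *: cov X Y
}.

Definition levi_civita (g : tensor02) (D : connection) :=
  (forall X Y, D X Y - D Y X = lie X Y) /\
  (forall X Y Z, X (g Y Z) = g (D X Y) Z + g Y (D X Z)).

Definition dual_connection (h : tensor02) (D D' : connection) :=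
  forall X Y Z, X (h Y Z) = h (D X Y) Z + h Y (D' X Z).

Definition cov_tensor11 (D : connection) (J : tensor11) (X Y : X_M) : X_M :=
  D X (J Y) - J (D X Y).

Lemma cov_form_linear (D : connection) X (beta : one_form M) :
  linear_for *%R (fun Y => X (beta Y) - beta (D X Y)).
Proof.
move=> f Y Z; rewrite cov_additive cov_leibniz -addrA !linearP.
rewrite vfield_funD vfield_leibniz mulrBr -[X in X - _]addrA.
by rewrite opprD addrACA subrr add0r opprD addrACA.
Qed.
Definition cov_form D X beta := mk_form (cov_form_linear D X beta).

Section AlphaConnection.
Variables (D D' : connection) (a : R).
Let u := cstC M ((1 + a) / 2).
Let v := cstC M ((1 - a) / 2).
Let cov_a X Y := u *: D X Y + v *: D' X Y.

Let uv : u + v = 1.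
Proof.
apply: val_inj; apply/funext => p /=; rewrite /GRing.add /= -mulrDl.
by rewrite addrACA subrr addr0 -[1 + 1]/(2%:R) divff ?pnatr_eq0.
Qed.

Lemma alpha_linear Y : linear (cov_a^~ Y).
Proof.
move=> f X Z; rewrite /cov_a !cov_linear !scalerDr !scalerA addrACA.
by rewrite ![_ * f]mulrC.
Qed.

Lemma alpha_additive X : {morph cov_a X : Y Z / Y + Z}.
Proof. by move=> Y Z; rewrite /cov_a !cov_additive !scalerDr addrACA. Qed.

Lemma alpha_leibniz X (f : C) Y :
  cov_a X (f *: Y) = X f *: Y + f *: cov_a X Y.
Proof.
rewrite /cov_a !cov_leibniz !scalerDr !scalerA addrACA -scalerDl -mulrDl.
by rewrite uv mul1r !(mulrC f).
Qed.

Definition alpha_connection :=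
  Connection alpha_linear alpha_additive alpha_leibniz.
End AlphaConnection.

(* A pair (X, eta) stands for the section X + eta of TM (+) T^*M. *)
Definition gsection := (X_M * one_form M)%type.

Definition bracket (D : connection) (s t : gsection) : gsection :=
  (lie s.1 t.1, cov_form D s.1 t.2 - cov_form D t.1 s.2).

Definition Jhat (h : tensor02) (J : tensor11) (s : gsection) : gsection :=
  (J s.1 + (sharp h s.2 - J (J (sharp h s.2))), h s.1 - pullback J s.2).

Definition nijenhuis (D : connection) (E : gsection -> gsection)
    (s t : gsection) : gsection :=
  bracket D (E s) (E t) - E (bracket D (E s) t) - E (bracket D s (E t))
  + E (E (bracket D s t)).

End Geometry.

(* Main.v *)
(* Write [h (X, Y) = g (X, J Y)] and [A X Y = (nabla_X J) Y].  Metricity of [nabla] gives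
   [J (nabla*_X Z) = nabla_X (J Z)], so [nabla* - nabla = J^-1 A] and
   [h (U, (nabla*_Y - nabla_Y) Z) = g (A U Y, Z)], where [A] is commutative and
   [g (A _ _, _)] totally symmetric.  As every 1-form is [h U = h(U, -)] for a
   unique [U], the brackets of [nabla^(alpha)] and [nabla] on [(X, h U)] and
   [(Y, h V)] differ by [(1 - alpha)/2] times the 1-form [g (A U Y - A V X)].
   The condition on [F] says that [J] can be moved freely through the
   product [A]; it is the difference of the Nijenhuis tensors on [(X, 0)] and
   [(Y, 0)], and it makes the difference on all other sections cancel. *)
Require Import Defs.
From mathcomp Require Import all_boot all_order all_algebra.
From mathcomp Require Import all_classical all_reals all_analysis.
From mathcomp Require Import ring.

Import GRing.Theory.

Local Open Scope ring_scope.

(** * The dual connection, and the action of the alpha-connections on 1-forms *)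

Section DualConnection.
Context {R : realType} {n : nat} {M : manifold R n}.
Implicit Types (D : connection M) (X Y Z U V : vfield M).
Implicit Types (eta beta : one_form M).

Lemma formDE eta beta Z : (eta + beta) Z = eta Z + beta Z.
Proof. by []. Qed.

Lemma formZE (u : Cinf M) eta Z : (u *: eta) Z = u * eta Z.
Proof. by []. Qed.

Lemma formNE eta Z : (- eta) Z = - eta Z.
Proof. by rewrite -scaleN1r formZE mulN1r. Qed.

Lemma gsectionD X Y eta beta :
  ((X, eta) + (Y, beta) : gsection M) = (X + Y, eta + beta).
Proof. by []. Qed.

Lemma tensor02Dl (g : tensor02 M) X Y Z : g (X + Y) Z = g X Z + g Y Z.
Proof. by rewrite linearD. Qed.

Lemma tensor02Nl (g : tensor02 M) X Z : g (- X) Z = - g X Z.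
Proof. by rewrite linearN formNE. Qed.

Lemma tensor02_0l (g : tensor02 M) Z : g 0 Z = 0.
Proof. by rewrite linear0. Qed.

Lemma tensor02Bl (g : tensor02 M) X Y Z : g (X - Y) Z = g X Z - g Y Z.
Proof. by rewrite linearB formDE formNE. Qed.

Lemma tensor02Br (g : tensor02 M) X Y Z : g Z (X - Y) = g Z X - g Z Y.
Proof. by rewrite linearB. Qed.

Definition tensorE (g : tensor02 M) (J : tensor11 M) := (@tensor02Dl g,
  @tensor02Nl g, fun X Y => linearD J X Y, fun X => linearN J X).

Lemma cov_opp D X Y : D X (- Y) = - D X Y.
Proof.
rewrite -[D X (- Y)](addrK (D X Y)) -cov_additive addNr.
by rewrite -[D X 0](addrK (D X 0)) -cov_additive addr0 subrr sub0r.
Qed.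

Lemma cov_tensor11D D (J : tensor11 M) X :
  {morph cov_tensor11 D J X : Y Z / Y + Z}.
Proof.
move=> Y Z.
by rewrite /cov_tensor11 raddfD !cov_additive raddfD opprD addrACA.
Qed.

Lemma cov_tensor11N D (J : tensor11 M) X Y :
  cov_tensor11 D J X (- Y) = - cov_tensor11 D J X Y.
Proof. by rewrite /cov_tensor11 raddfN !cov_opp raddfN opprD. Qed.

(** Differentiate [g (J Y) Z = g Y (J Z)] along [X] and expand both sides by metricity. *)
Lemma cov_tensor11_self_adjoint (g : tensor02 M) D (J : tensor11 M) X Y Z :
  (forall X Y Z, X (g Y Z) = g (D X Y) Z + g Y (D X Z)) ->
  g_symmetric g J ->
  g (cov_tensor11 D J X Y) Z = g Y (cov_tensor11 D J X Z).
Proof.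
move=> gD gJ; rewrite /cov_tensor11 tensor02Bl tensor02Br gJ.
apply/eqP; rewrite subr_eq addrAC -subr_eq opprK; apply/eqP.
by rewrite -(gJ Y) -gD gJ gD addrC.
Qed.

(** Since [twist g J Y Z] is [g Y (J Z)], duality and metricity at [Y], [J Z] differ only in the
    term paired with [Y]. *)
Lemma dual_connection_twist {g : tensor02 M} {D D' : connection M}
    {J : tensor11 M} X Z :
  (forall X Y, g X Y = g Y X) -> injective g ->
  (forall X Y Z, X (g Y Z) = g (D X Y) Z + g Y (D X Z)) ->
  dual_connection (twist g J) D D' -> J (D' X Z) = D X (J Z).
Proof.
move=> gC gI gD dD; apply: gI; apply: one_form_eqP => Y.
rewrite gC [RHS]gC; apply: (addrI (g (D X Y) (J Z))).
by rewrite -gD; symmetry; exact: dD.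
Qed.

(** The two weights sum to 1, so the connection is [D] plus [(1 - a) / 2] times [D' - D]; passing to
    1-forms reverses the sign. *)
Lemma cov_form_alpha D D' (a : R) X beta Z :
  cov_form (alpha_connection D D' a) X beta Z =
  cov_form D X beta Z - cstC M ((1 - a) / 2) * (beta (D' X Z) - beta (D X Z)).
Proof.
have uv : cstC M ((1 + a) / 2) = 1 - cstC M ((1 - a) / 2).
  have uvR : (1 + a) / 2 = 1 - (1 - a) / 2 by field.
  by apply: val_inj; apply/funext => p; exact: uvR.
by rewrite /= raddfD /= !linearZ /= uv; ring.
Qed.

End DualConnection.

(** * [Jhat] as a block matrix over vector fields *)

Section GeneralizedProduct.
Context {R : realType} {n : nat} {M : manifold R n}.
Context {g : tensor02 M} {J : tensor11 M}.
Implicit Types X Y Z U V : vfield M.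
Hypothesis (gB : bijective g).
Hypotheses (JU : tensor_invertible J) (gJ : g_symmetric g J).
Local Notation h := (twist g J).
Local Notation Jh := (Jhat h J).

Lemma twistE X : h X = g (J X).
Proof. by apply: one_form_eqP => Z; rewrite gJ. Qed.

Lemma metric_ext X Y : (forall Z, g X Z = g Y Z) -> X = Y.
Proof. by move=> XY; apply: (bij_inj gB); apply: one_form_eqP; exact: XY. Qed.

Lemma twist_inj : injective h.
Proof.
move=> X Y; rewrite !twistE => /(bij_inj gB).
by have [K [JK _]] := JU => /(can_inj JK).
Qed.

Lemma sharpK eta : h (sharp h eta) = eta.
Proof.
have [k _ gk] := gB; have [K [_ KJ]] := JU.
(* The witness is [J^-1 (g^-1 eta)]: every 1-form is in the range of [h], so [sharp] never returns
   its default value. *)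
have hP : exists X, h X = eta by exists (K (k eta)); rewrite twistE KJ gk.
exact: (xgetPex 0 hP).
Qed.

Lemma twistK X : sharp h (h X) = X.
Proof. by apply: twist_inj; rewrite sharpK. Qed.

Lemma pullback_twist X : pullback J (h X) = h (J X).
Proof. by apply: one_form_eqP => Z; exact/esym/gJ. Qed.

(** With 1-forms identified with vector fields through [h], [Jhat] is the matrix with rows
    [(J, I - J^2)] and [(I, -J)]. *)
Lemma JhatE X U : Jh (X, h U) = (J X + (U - J (J U)), h (X - J U)).
Proof. by rewrite linearB -pullback_twist -{2 3}[U]twistK. Qed.

Lemma gsection_ind (P : gsection M -> Prop) :
  (forall X U, P (X, h U)) -> forall s, P s.
Proof. by move=> PX [X eta]; rewrite -[eta]sharpK. Qed.

Lemma JhatD : {morph Jh : s t / s + t}.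
Proof.
elim/gsection_ind => X U; elim/gsection_ind => Y V.
have hD X1 U1 X2 U2 : (X1, h U1) + (X2, h U2) = (X1 + X2, h (U1 + U2)).
  by rewrite linearD.
rewrite hD !JhatE hD; congr (_, h _).
  (* Pairing with an arbitrary [Z] turns a vector identity into one between functions, where [ring]
     applies. *)
  by apply: metric_ext => Z; rewrite !(tensorE g J); ring.
by apply: metric_ext => Z; rewrite !(tensorE g J); ring.
Qed.

Lemma Jhat0 : Jh 0 = 0.
Proof. by apply: (addrI (Jh 0)); rewrite -JhatD !addr0. Qed.

(** The entries of the matrix are polynomials in [J], hence commute, and its square is the
    identity. *)
Lemma JhatK : involutive Jh.
Proof.
elim/gsection_ind => X U; rewrite !JhatE; congr (_, h _);
  by apply: metric_ext => Z; rewrite !(tensorE g J); ring.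
Qed.

End GeneralizedProduct.

(** * The difference of the two Nijenhuis tensors *)

Section Difference.
Context {R : realType} {n : nat} {M : manifold R n}.
Context {g : tensor02 M} {J : tensor11 M} {D D' : connection M}.
Implicit Types X Y Z U V : vfield M.
Hypotheses (gC : forall X Y, g X Y = g Y X) (gB : bijective g).
Hypothesis (gD : forall X Y Z, X (g Y Z) = g (D X Y) Z + g Y (D X Z)).
Hypotheses (JU : tensor_invertible J) (gJ : g_symmetric g J).
Hypothesis (dD : dual_connection (twist g J) D D').
Local Notation A := (cov_tensor11 D J).
Hypothesis (symA : forall X Y, A X Y = A Y X).
Local Notation h := (twist g J).
Local Notation Jh := (Jhat h J).

Lemma twist_dual_diff U Y Z : h U (D' Y Z) - h U (D Y Z) = g (A U Y) Z.
Proof.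
rewrite /= (dual_connection_twist _ _ gC (bij_inj gB) gD dD).
by rewrite -tensor02Br -(cov_tensor11_self_adjoint _ _ _ _ _ _ gD gJ) symA.
Qed.

(** The [g]-dual of the change in the 1-form part of the bracket, without the factor [(1 - a) / 2];
    the Lie bracket part does not change. *)
Definition bracket_shift (s t : gsection M) : vfield M :=
  A (sharp h s.2) t.1 - A (sharp h t.2) s.1.

Lemma bracket_alpha a s t :
  bracket (alpha_connection D D' a) s t =
  bracket D s t + (0, cstC M ((1 - a) / 2) *: g (bracket_shift s t)).
Proof.
rewrite /bracket gsectionD addr0; congr (_, _).
apply: one_form_eqP => Z; rewrite !formDE !formNE formZE !cov_form_alpha.
by rewrite tensor02Bl -!twist_dual_diff !sharpK //; ring.
Qed.

(** Each of the four brackets contributes its shift. As [Jh] is an additive involution, the outer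
    two combine outside [Jh] and the mixed two under a single [Jh]. *)
Lemma nijenhuis_alpha a s t :
  let w X := (0, cstC M ((1 - a) / 2) *: g X) in
  nijenhuis (alpha_connection D D' a) Jh s t =
  nijenhuis D Jh s t +
  (w (bracket_shift (Jh s) (Jh t) + bracket_shift s t)
   - Jh (w (bracket_shift (Jh s) t + bracket_shift s (Jh t)))).
Proof.
move=> w.
have wD X Y : w (X + Y) = w X + w Y.
  by rewrite gsectionD addr0 -scalerDr -linearD.
rewrite /nijenhuis !bracket_alpha -!/(w _) !wD !JhatD // !JhatK // !opprD.
by rewrite [LHS](AC (2*2*2*2) ((1*3*5*7)*((2*8)*(4*6)))).
Qed.

Lemma bracket_shiftE X U Y V :
  bracket_shift (X, h U) (Y, h V) = A U Y - A V X.
Proof. by rewrite /bracket_shift !twistK. Qed.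

Lemma cov_tensor11_0l X : A 0 X = 0.
Proof.
by rewrite symA -[RHS](subrr (A X 0)) -cov_tensor11N -cov_tensor11D subrr.
Qed.

(** At [a = -1] the factor is 1. Since [Jh (X, 0)] is [(J X, h X)], the mixed shifts cancel by
    symmetry of [A] and only the shift of the two images survives. *)
Lemma nijenhuis_diff_vfields X Y :
  nijenhuis (alpha_connection D D' (-1)) Jh (X, 0) (Y, 0) =
  nijenhuis D Jh (X, 0) (Y, 0) + (0, g (A X (J Y) - A Y (J X))).
Proof.
have c1 : cstC M ((1 - -1) / 2) = 1.
  have c1R : (1 - -1) / 2 = 1 :> R by field.
  by apply: val_inj; apply/funext => p; exact: c1R.
rewrite -(linear0 h) nijenhuis_alpha c1 !scale1r !JhatE // !bracket_shiftE.
rewrite !linear0 !addr0 !cov_tensor11_0l (symA Y X) !subr0 add0r subrr.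
by rewrite addr0 linear0 -[(0, 0)]/(0 : gsection M) Jhat0 // subr0.
Qed.

Section Commuting.
Hypothesis AJ : forall X Y, A X (J Y) = A Y (J X).

(** By symmetry of [A], [AJ] says that [A X] composed with [J] is [A (J X)], which is self-adjoint;
    taking adjoints, [A X] commutes with [J]. *)
Lemma cov_tensor11_commr X Y : A X (J Y) = J (A X Y).
Proof.
apply: (metric_ext gB) => Z.
have adj X' Y' Z' := cov_tensor11_self_adjoint _ _ _ X' Y' Z' gD gJ.
by rewrite AJ symA adj gJ [RHS]adj [in RHS]AJ (symA Z).
Qed.

Lemma cov_tensor11_comml X Y : A (J X) Y = J (A X Y).
Proof. by rewrite symA AJ cov_tensor11_commr. Qed.

Lemma bracket_shift_Jhat s t :
  bracket_shift (Jh s) t + bracket_shift s (Jh t) = 0 /\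
  bracket_shift (Jh s) (Jh t) + bracket_shift s t = 0.
Proof.
move: s t; elim/(gsection_ind gB JU gJ) => X U.
elim/(gsection_ind gB JU gJ) => Y V.
have Al X1 X2 Z : A (X1 + X2) Z = A X1 Z + A X2 Z.
  by rewrite symA cov_tensor11D !(symA Z).
have An X1 Z : A (- X1) Z = - A X1 Z by rewrite symA cov_tensor11N (symA Z).
rewrite !JhatE // !bracket_shiftE.
rewrite !(Al, An, cov_tensor11D, cov_tensor11N, cov_tensor11_comml,
  cov_tensor11_commr) !(symA Y) !(symA V).
(* Once [J] is pulled out, both sums are combinations of four products with coefficients polynomial
   in [J], and all coefficients vanish. *)
move: (A X Y) (A X V) (A U Y) (A U V) => XY XV UY UV.
by split; apply: (metric_ext gB) => Z; rewrite tensor02_0l !(tensorE g J); ring.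
Qed.

End Commuting.

End Difference.

Theorem proposition5p6 (R : realType) (n : nat) (M : manifold R n)
    (g : tensor02 M) (nabla : connection M) (J : tensor11 M)
    (nabla_star : connection M) :
  pseudo_riemannian g ->
  levi_civita g nabla ->
  tensor_invertible J ->
  g_symmetric g J ->
  (forall X Y : vfield M, cov_tensor11 nabla J X Y = cov_tensor11 nabla J Y X) ->
  dual_connection (twist g J) nabla nabla_star ->
  (forall (X Y : vfield M) (eta beta : one_form M) (alpha : R),
     nijenhuis (alpha_connection nabla nabla_star alpha)
       (Jhat (twist g J) J) (X, eta) (Y, beta) =
     nijenhuis nabla (Jhat (twist g J) J) (X, eta) (Y, beta))
  <->
  (let F (X Y Z : vfield M) : Cinf M :=
     twist g J (cov_tensor11 nabla J X Y) Z in
   forall X Y Z : vfield M, F Y Z X - F X Z Y = 0).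
Proof.
move=> [gC gB] [_ gD] JU gJ symA dD; set A := cov_tensor11 nabla J in symA *.
(* Self-adjointness frees [Z], so by nondegeneracy the condition on [F] amounts to
   [A X (J Y) = A Y (J X)]. *)
have FE X Y Z : twist g J (A Y Z) X = g Z (A Y (J X)).
  by rewrite -(cov_tensor11_self_adjoint _ _ _ _ _ _ gD gJ).
split=> [N F X Y Z|F0 X Y eta beta a].
  (* The case [alpha = -1] with zero 1-forms already forces the condition. *)
  have := nijenhuis_diff_vfields gC gB gD JU gJ dD symA X Y.
  rewrite N -{1}[nijenhuis _ _ _ _]addr0 => /addrI/(congr1 snd) gA0.
  by rewrite /F !FE -opprB -tensor02Br gC -[g _]gA0 oppr0.
have AJ X' Y' : A X' (J Y') = A Y' (J X').
  apply: (metric_ext gB) => Z; apply/eqP; rewrite -subr_eq0 ![g _ Z]gC -!FE.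
  by rewrite F0.
rewrite (nijenhuis_alpha gC gB gD JU gJ dD symA).
have [-> ->] := bracket_shift_Jhat gB gD JU gJ symA AJ (X, eta) (Y, beta).
by rewrite linear0 scaler0 -[(0, 0)]/(0 : gsection M) Jhat0 // subr0 addr0.
Qed.
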